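(* Let $K$ be a field, $n\geq 2$ an integer, and $S=K[x_{ij},y_j \mid 1\leq i\leq n+1,\ 1\leq j\leq n]$ the polynomial ring in the indicated distinct indeterminates. Let $\widehat{X}=(x_{ij})_{(n+1)\times n}$ and $Y=(y_j)_{n\times 1}$ be the corresponding generic matrices, let $g_i=\sum_{j=1}^n x_{ij}y_j$ for $1\leq i\leq n+1$, and let $I_1(\widehat{X}Y)=\langle g_1,\ldots,g_{n+1}\rangle$. For $1\leq i\leq n+1$ let $\Delta_i$ denote the determinant of the $n\times n$ matrix obtained by deleting the $i$-th row of $\widehat{X}$. Then: (i) The sequence $g_1,\ldots,g_{n+1}$ is a $d$-sequence in $S$. (ii) The Rees algebra of $I_1(\widehat{X}Y)$ is isomorphic to $S[T_1,\ldots,T_{n+1}]/\mathfrak{I}$, where $T_1,\ldots,T_{n+1}$ are indeterminates over $S$ and $\mathfrak{I}\subset S[T_1,\ldots,T_{n+1}]$ is the ideal generated by the set $$\Big\{T_ig_j-T_jg_i \ \Big|\ 1\leq i,j\leq n+1\Big\}\cup\Big\{\sum_{k=1}^{n+1}(-1)^k\Delta_kT_k\Big\}.$$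
   Context: A sequence $a_1,\ldots,a_m$ of elements of a commutative ring $A$ is a $d$-sequence if, setting $a_0=0$, one has $(\langle a_0,\ldots,a_i\rangle : a_{i+1}a_j)=(\langle a_0,\ldots,a_i\rangle : a_j)$ for all $0\leq i\leq m-1$ and all $i+1\leq j\leq m$. The Rees algebra of an ideal $I=\langle a_1,\ldots,a_m\rangle$ of a Noetherian ring $R$ is the $R$-subalgebra $R[It]=R[a_1t,\ldots,a_mt]$ of $R[t]$. $I_1(M)$ denotes the ideal generated by the entries of a matrix $M$. *)

(* Defs.v *)
From HB Require Import structures.
From mathcomp Require Import all_boot all_order all_algebra.
From mathcomp Require Import generic_quotient ring_quotient.
From mathcomp Require Import boolp mpoly.

Set Implicit Arguments.
Unset Strict Implicit.
Unset Printing Implicit Defensive.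

Import GRing.Theory.
Local Open Scope ring_scope.
Local Open Scope quotient_scope.

Section Ideals.
Variable A : comNzRingType.
Implicit Types (s : seq A) (J : {pred A}).

Definition ideal_gen s : {pred A} :=
  fun x => `[< exists c : nat -> A, x = \sum_(i < size s) c i * s`_i >].

Lemma ideal_genP s x :
  reflect (exists c : nat -> A, x = \sum_(i < size s) c i * s`_i)
          (x \in ideal_gen s).
Proof. exact: asboolP. Qed.

Lemma ideal_gen0 s : 0 \in ideal_gen s.
Proof.
by apply/ideal_genP; exists (fun=> 0); rewrite big1 // => i _; rewrite mul0r.
Qed.

Lemma ideal_genMD s a : {in ideal_gen s &, forall u v, a * u + v \in ideal_gen s}.
Proof.
move=> u v /ideal_genP[c ->] /ideal_genP[d ->]; apply/ideal_genP.
exists (fun i => a * c i + d i); rewrite mulr_sumr -big_split /=.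
by apply: eq_bigr => i _; rewrite mulrDl mulrA.
Qed.

Lemma mem_ideal_gen s x : x \in s -> x \in ideal_gen s.
Proof.
move=> xs; have ltis : (index x s < size s)%N by rewrite index_mem.
apply/ideal_genP; exists (fun i => (i == index x s)%:R).
rewrite (bigD1 (Ordinal ltis)) //= eqxx mul1r nth_index // big1 ?addr0 //.
by move=> i; rewrite -val_eqE /= => /negPf->; rewrite mul0r.
Qed.

Lemma ideal_gen_sub s (P : {pred A}) :
  0 \in P -> (forall a, {in P &, forall u v, a * u + v \in P}) ->
  {subset s <= P} -> {subset ideal_gen s <= P}.
Proof.
move=> P0 Plin sP x /ideal_genP[c ->].
apply: (big_ind (fun y => y \in P)) => // [u v Pu Pv|i _].
  by rewrite -[u]mul1r Plin.
by rewrite -[_ * _]addr0 Plin // sP // mem_nth.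
Qed.

Definition colon J x : {pred A} := [pred r | r * x \in J].

(* The sequence is prefixed with a_0 = 0, so that [(0 :: a)`_i] is the
   1-indexed a_i and [take i.+1 (0 :: a)] is a_0, ..., a_i. *)
Definition d_sequence (a : seq A) : Prop :=
  forall i j : nat, (i <= (size a).-1)%N -> (i.+1 <= j <= size a)%N ->
    let J := ideal_gen (take i.+1 (0 :: a)) in
    colon J ((0 :: a)`_i.+1 * (0 :: a)`_j) =i colon J (0 :: a)`_j.

End Ideals.

Definition entry_ideal (A : comNzRingType) (p q : nat) (M : 'M[A]_(p, q)) :
    {pred A} :=
  ideal_gen [seq M i j | i <- enum 'I_p, j <- enum 'I_q].

Section Rees.
Variables (A : comNzRingType) (J : {pred A}).

(* The smallest A-subalgebra of A[t] (with t = 'X) containing a t for all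
   a in J; see [rees_pred_gen] for the version on generators of J. *)
Definition rees_pred : {pred {poly A}} :=
  fun p => `[< forall P : {pred {poly A}}, GRing.subalg_closed P ->
                 (forall a, a \in J -> a *: 'X \in P) -> p \in P >].

Lemma rees_pred_closed : GRing.subalg_closed rees_pred.
Proof.
split=> [|a u v /asboolP Ju /asboolP Jv|u v /asboolP Ju /asboolP Jv];
  apply/asboolP => P Pcl JP; case: (Pcl) => P1 Plin Pmul //.
  by apply: Plin; [exact: Ju | exact: Jv].
by apply: Pmul; [exact: Ju | exact: Jv].
Qed.

HB.instance Definition _ := GRing.isSubalgClosed.Build A {poly A} rees_pred
  (GRing.subalg_closed_semi rees_pred_closed).

Record rees_algebra :=
  ReesAlgebra { rees_val :> {poly A}; _ : rees_val \in rees_pred }.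

HB.instance Definition _ := [isSub for rees_val].
HB.instance Definition _ := [Choice of rees_algebra by <:].
HB.instance Definition _ := [SubChoice_isSubLalgebra of rees_algebra by <:].
HB.instance Definition _ := [SubNzRing_isSubComNzRing of rees_algebra by <:].
HB.instance Definition _ := [SubLalgebra_isSubAlgebra of rees_algebra by <:].

End Rees.

Lemma rees_pred_gen (A : comNzRingType) (s : seq A) (p : {poly A}) :
  p \in rees_pred (ideal_gen s) <->
  (forall P : {pred {poly A}}, GRing.subalg_closed P ->
     {in s, forall a, a *: 'X \in P} -> p \in P).
Proof.
split=> [/asboolP Jp P Pcl sP|sp]; last first.
  by apply/asboolP => P Pcl JP; apply: sp => // a /mem_ideal_gen/JP.
apply: Jp => // a; case: Pcl => P1 Plin _.
have P0 : 0 \in P by rewrite -[0](subrr 1) addrC -scaleN1r Plin.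
apply: (@ideal_gen_sub _ s [pred a | a *: 'X \in P]) => [|b u v|]; rewrite ?inE.
- by rewrite scale0r.
- by move=> Pu Pv; rewrite scalerDl -scalerA Plin.
- by move=> b /sP.
Qed.

Section QuotientAlgebra.
Variables (A : comNzRingType) (B : comAlgType A) (I : idealr B).
Local Notation Q := {ideal_quot I}.

Definition quot_scale (a : A) (x : Q) : Q := \pi_Q (a%:A) * x.

Fact quot_scaleA a b x : quot_scale a (quot_scale b x) = quot_scale (a * b) x.
Proof. by rewrite /quot_scale mulrA -rmorphM /= -scalerAl mul1r scalerA. Qed.

Fact quot_scale1 : left_id 1 quot_scale.
Proof. by move=> x; rewrite /quot_scale scale1r rmorph1 mul1r. Qed.

Fact quot_scaleDr : right_distributive quot_scale +%R.
Proof. by move=> a x y; rewrite /quot_scale mulrDr. Qed.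

Fact quot_scaleDl x : {morph quot_scale^~ x : a b / a + b}.
Proof. by move=> a b; rewrite /quot_scale scalerDl rmorphD mulrDl. Qed.

HB.instance Definition _ := GRing.Zmodule_isLmodule.Build A Q
  quot_scaleA quot_scale1 quot_scaleDr quot_scaleDl.

Fact quot_scaleAl (a : A) (x y : Q) : a *: (x * y) = (a *: x) * y.
Proof. exact: mulrA. Qed.

HB.instance Definition _ := GRing.Lmodule_isLalgebra.Build A Q quot_scaleAl.
HB.instance Definition _ := GRing.Lalgebra_isComAlgebra.Build A Q.

End QuotientAlgebra.

Section Generic.
Variables (K : fieldType) (n : nat).

(* The first (n + 1) * n variables are the x_ij, the last n are the y_j. *)
Local Notation S := {mpoly K[n.+1 * n + n]}.

Definition genX : 'M[S]_(n.+1, n) :=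
  \matrix_(i, j) 'X_(lshift n (mxvec_index i j)).

Definition genY : 'cV[S]_n := \col_j 'X_(rshift (n.+1 * n) j).

Definition g (i : 'I_n.+1) : S := \sum_(j < n) genX i j * genY j 0.

Definition gseq : seq S := [seq g i | i <- enum 'I_n.+1].

Lemma entry_ideal_gE : entry_ideal (genX *m genY) = ideal_gen gseq.
Proof.
rewrite /entry_ideal (enum_ordSl 0) enum_ord0 /= /gseq.
congr ideal_gen; elim: (enum 'I_n.+1) => //= i s ->.
by rewrite mxE; congr (_ :: _).
Qed.

Definition Delta (i : 'I_n.+1) : S := \det (row' i genX).

(* Ordinals start at 0, whence the exponent k.+1 in the signs. *)
Definition rees_relations : seq {mpoly S[n.+1]} :=
  rcons [seq 'X_i * (g j)%:MP - 'X_j * (g i)%:MP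
           | i <- enum 'I_n.+1, j <- enum 'I_n.+1]
        (\sum_(k < n.+1) (-1) ^+ k.+1 * (Delta k)%:MP * 'X_k).

Definition rees_ideal : {pred {mpoly S[n.+1]}} := ideal_gen rees_relations.

(* Every relation vanishes at T = 0, so the ideal is proper, as the quotient
   construction of the library requires. *)
Lemma rees_ideal_closed : idealr_closed rees_ideal.
Proof.
split; [exact: ideal_gen0 | | exact: ideal_genMD].
pose P : {pred {mpoly S[n.+1]}} := [pred p | p@_0%MM == 0].
have PX i (p : {mpoly S[n.+1]}) : 'X_i * p \in P.
  by rewrite inE rmorphM /= mcoeffX mnm1_eq0 mul0r.
apply/negP => J1; suff: 1 \in P by rewrite inE mcoeff1 eqxx oner_eq0.
move: J1; apply: ideal_gen_sub => [|a u v|p].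
- by rewrite inE mcoeff0.
- by rewrite !inE rmorphD rmorphM /= => /eqP-> /eqP->; rewrite mulr0 addr0.
rewrite mem_rcons inE => /orP[/eqP->|/allpairsP[[i j] [_ _ ->]] /=].
  rewrite inE raddf_sum /= big1 // => k _; apply/eqP.
  by rewrite mulrC; exact: PX.
by move: (PX i (g j)%:MP) (PX j (g i)%:MP); rewrite !inE raddfB /=
  => /eqP-> /eqP->; rewrite subr0.
Qed.

HB.instance Definition _ := isIdealr.Build _ rees_ideal rees_ideal_closed.

End Generic.

Arguments rees_ideal K n : clear implicits.

(* Main.v *)
From HB Require Import structures.
Require Import Defs.
From mathcomp Require Import all_boot all_order all_algebra.
From mathcomp Require Import ring zify.
From mathcomp Require Import generic_quotient ring_quotient.
From mathcomp Require Import boolp mpoly.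

(* Write J_i = (g_1, ..., g_i) and D_m for the upper left m x m minor of X.
   A polynomial whose leading coefficient in one variable is regular modulo an
   ideal not involving that variable is itself regular, so g_i is regular
   modulo such an ideal as soon as some y_j is.  Exchanging the last two terms
   of a regular sequence then makes g_1, ..., g_n regular.  By Cramer,
   y_j D_m lies in (C_j g_m) + J_(m-1) + (y_k : k > m) with C_j a cofactor;
   by induction on m this makes y_m, hence g_(m+1), regular modulo
   (D_m) + J_m + (y_k : k > m).  For m = n this gives
   J_n : g_(n+1) = J_n + (D_n) = J_n : g_(n+1)^2, whence the d-sequence
   property.  A d-sequence is of linear type: since J_i \cap J^(d+1) is
   contained in J_i J^d, a form in the T_k vanishing at g is reduced, modulo
   relations of smaller degree, to forms in fewer and fewer of the leading
   factors T_k, and only linear syzygies remain; these are generated by the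
   Koszul ones and the one with coefficients the maximal minors. *)

Set Implicit Arguments.
Unset Strict Implicit.
Unset Printing Implicit Defensive.

Import GRing.Theory.
Local Open Scope ring_scope.

(** * Ideals and regularity *)

Fact ideal_gen_zmod_closed (A : comNzRingType) (s : seq A) :
  zmod_closed (ideal_gen s).
Proof.
split=> [|x y sx sy]; first exact: ideal_gen0.
by rewrite addrC -mulN1r ideal_genMD.
Qed.

HB.instance Definition _ (A : comNzRingType) (s : seq A) :=
  GRing.isZmodClosed.Build A (ideal_gen s) (ideal_gen_zmod_closed s).

Lemma ideal_genMl (A : comNzRingType) (s : seq A) a x :
  x \in ideal_gen s -> a * x \in ideal_gen s.
Proof. by move=> sx; rewrite -[a * x]addr0 ideal_genMD ?rpred0. Qed.

Lemma ideal_genMr (A : comNzRingType) (s : seq A) a x :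
  x \in ideal_gen s -> x * a \in ideal_gen s.
Proof. by rewrite mulrC; exact: ideal_genMl. Qed.

Lemma ideal_gen_subset (A : comNzRingType) (s t : seq A) :
  {subset s <= ideal_gen t} -> {subset ideal_gen s <= ideal_gen t}.
Proof.
by move=> st; apply: ideal_gen_sub => //; [exact: rpred0 | exact: ideal_genMD].
Qed.

Lemma ideal_gen_mono (A : comNzRingType) (s t : seq A) :
  {subset s <= t} -> {subset ideal_gen s <= ideal_gen t}.
Proof. by move=> st; apply: ideal_gen_subset => x /st/mem_ideal_gen. Qed.

Lemma ideal_gen_consP (A : comNzRingType) (a : A) (s : seq A) x :
  x \in ideal_gen (a :: s) <->
  exists c y, y \in ideal_gen s /\ x = c * a + y.
Proof.
split=> [/ideal_genP[c ->]|[c [y [sy ->]]]].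
  exists (c 0%N), (\sum_(i < size s) c i.+1 * s`_i); split.
    by apply/ideal_genP; exists (c \o succn).
  by rewrite big_ord_recl.
rewrite rpredD //; first by rewrite ideal_genMl ?mem_ideal_gen ?mem_head.
by apply: (ideal_gen_mono _ sy) => z; rewrite inE orbC => ->.
Qed.

Lemma mem_mkseq (T : eqType) (f : nat -> T) i k :
  (k < i)%N -> f k \in mkseq f i.
Proof. by move=> ltki; apply: map_f; rewrite mem_iota. Qed.

Lemma ideal_gen_mkseqP (A : comNzRingType) (f : nat -> A) (i : nat) x :
  reflect (exists c : nat -> A, x = \sum_(k < i) c k * f k)
          (x \in ideal_gen (mkseq f i)).
Proof.
apply: (iffP (ideal_genP _ _)) => -[c ->]; exists c; rewrite size_mkseq;
  by apply: eq_bigr => k _; rewrite nth_mkseq.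
Qed.

(** The ideal may be the whole ring: the induction in [nzd_row_form_corner] starts from such a case,
    with the empty minor equal to 1. *)
Definition nzd_mod (A : comNzRingType) (s : seq A) (a : A) : Prop :=
  forall u, a * u \in ideal_gen s -> u \in ideal_gen s.

Lemma nzd_mod_eq_mem (A : comNzRingType) (s t : seq A) a :
  s =i t -> nzd_mod s a -> nzd_mod t a.
Proof.
move=> st sa u tau; apply: (@ideal_gen_mono _ s t) => [x|]; first by rewrite st.
by apply/sa; apply: ideal_gen_mono tau => x; rewrite st.
Qed.

(** From a u = c b + y, regularity of b gives c = d a + z; then a (u - d b) = b z + y lies in the
    ideal of [s], and a cancels. *)
Lemma nzd_mod_swap (A : comNzRingType) (s : seq A) a b :
  nzd_mod s a -> nzd_mod (a :: s) b -> nzd_mod (b :: s) a.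
Proof.
move=> sa sb u /ideal_gen_consP[c [y [sy au]]].
have /ideal_gen_consP[d [z [sz cE]]] : c \in ideal_gen (a :: s).
  apply: sb; apply/ideal_gen_consP; exists u, (- y).
  by rewrite rpredN; split=> //; rewrite mulrC [u * a]mulrC au addrK.
apply/ideal_gen_consP; exists d, (u - d * b); split; last by rewrite addrCA subrr addr0.
apply: sa; have -> : a * (u - d * b) = b * z + y.
  by rewrite mulrBr au cE; ring.
by rewrite rpredD ?ideal_genMl.
Qed.

(* [sigma] is the expansion of A in powers of [v], as for a polynomial
   ring A = A'[v]; the elements with [sigma f = f%:P] are those of A'. *)
Section Expansion.
Variables (A : comNzRingType) (v : A) (sigma : {rmorphism A -> {poly A}}).
Hypothesis sigmaK : forall f, (sigma f).[v] = f.
Hypothesis sigmaX : sigma v = 'X.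

Lemma expansion_coef (s : seq A) x i :
  {in s, forall f, sigma f = f%:P} -> x \in ideal_gen s ->
  (sigma x)`_i \in ideal_gen s.
Proof.
move=> sP /ideal_genP[c ->]; rewrite rmorph_sum coef_sum rpred_sum //= => k _.
rewrite rmorphM (sP s`_k) ?mem_nth // coefMC.
by rewrite ideal_genMl // mem_ideal_gen ?mem_nth.
Qed.

(* McCoy: a polynomial whose leading coefficient is regular is regular. *)
Lemma nzd_mod_linear (s : seq A) a b :
  {in s, forall f, sigma f = f%:P} -> sigma a = a%:P -> sigma b = b%:P ->
  nzd_mod s a -> nzd_mod s (a * v + b).
Proof.
move=> sP sa sb nza u /(expansion_coef _ sP) uP.
have coefP i : (sigma u)`_i \in ideal_gen s.
  (* Descending induction on i: the coefficient of index i + 1 in (a v + b) u is a u_i + b u_(i+1),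
     and u_(i+1) is already in the ideal. *)
  have [k] := ubnP (size (sigma u) - i); elim: k i => // k IHk i.
  case: (leqP (size (sigma u)) i) => [/(nth_default 0)-> _|ltiu].
    by rewrite rpred0.
  rewrite ltnS => leuk; apply: nza.
  have uS : (sigma u)`_i.+1 \in ideal_gen s.
    by apply: IHk; apply: leq_trans leuk; rewrite ltn_sub2l.
  have := uP i.+1; rewrite rmorphM rmorphD rmorphM sa sb sigmaX /=.
  rewrite mulrDl coefD -mulrA coefCM coefXM /= coefCM => auP.
  by rewrite -(addrK (b * (sigma u)`_i.+1) (a * _)) rpredB ?ideal_genMl.
rewrite -[u]sigmaK horner_coef rpred_sum // => i _.
by rewrite ideal_genMr.
Qed.

End Expansion.

(** The coefficients stay in the full ring, which avoids an isomorphism with a polynomial ring in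
    one variable less. *)
Lemma mpoly_expansion (R : comNzRingType) (N : nat) (v : 'I_N) :
  exists sigma : {rmorphism {mpoly R[N]} -> {poly {mpoly R[N]}}},
    [/\ forall f, (sigma f).['X_v] = f, sigma 'X_v = 'X
      & forall i, i != v -> sigma 'X_i = ('X_i)%:P].
Proof.
pose X i : {poly {mpoly R[N]}} := if i == v then 'X else ('X_i)%:P.
pose sigma0 : {rmorphism {mpoly R[N]} -> {poly {mpoly R[N]}}} :=
  mmap (polyC \o @mpolyC N R) X.
have: exists sigma : {rmorphism {mpoly R[N]} -> {poly {mpoly R[N]}}},
    (forall c, sigma c%:MP = c%:MP%:P) /\ (forall i, sigma 'X_i = X i).
  by exists sigma0; split=> [c|i]; rewrite /= ?mmapC ?mmapX ?mmap1U.
case=> sigma [sC sX]; exists sigma; split=> [f||i neiv].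
- elim/mpolyind: f => [|c m p _ _ IHp]; first by rewrite rmorph0 horner0.
  rewrite rmorphD hornerD; congr (_ + _); last exact: IHp.
  rewrite -mul_mpolyC rmorphM hornerM sC hornerC; congr (_ * _).
  rewrite mpolyXE_id rmorph_prod horner_prod; apply: eq_bigr => i _.
  rewrite rmorphXn horner_exp /= sX /X.
  by case: eqP => [->|_]; rewrite (hornerX, hornerC).
- by rewrite sX /X eqxx.
- by rewrite sX /X (negPf neiv).
Qed.

(** * Generic matrices *)

Section GenericMatrix.
Variables (A : comNzRingType) (n : nat) (x : nat -> nat -> A) (y : nat -> A).

(** Natural number indices let the corners of all sizes share their entries without casts; rows run
    from 0 to n and columns from 0 to n - 1. *)
Definition x_expansion i j (sigma : {rmorphism A -> {poly A}}) : Prop :=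
  [/\ forall f, (sigma f).[x i j] = f, sigma (x i j) = 'X,
      forall i' j', (i' <= n)%N -> (j' < n)%N -> (i', j') != (i, j) ->
        sigma (x i' j') = (x i' j')%:P
    & forall j', (j' < n)%N -> sigma (y j') = (y j')%:P].

Definition y_expansion j (sigma : {rmorphism A -> {poly A}}) : Prop :=
  [/\ forall f, (sigma f).[y j] = f, sigma (y j) = 'X
    & forall j', (j' < n)%N -> j' != j -> sigma (y j') = (y j')%:P].

Hypothesis x_indet : forall i j, (i <= n)%N -> (j < n)%N ->
  exists sigma, x_expansion i j sigma.
Hypothesis y_indet : forall j, (j < n)%N -> exists sigma, y_expansion j sigma.

Definition row_form i : A := \sum_(j < n) x i j * y j.

Definition corner m : 'M[A]_m := \matrix_(i < m, j < m) x i j.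

Local Notation g := row_form.
Local Notation J i := (mkseq row_form i).

Lemma expansion_det m (M : 'M[A]_m) (sigma : {rmorphism A -> {poly A}}) :
  (forall i j, sigma (M i j) = (M i j)%:P) -> sigma (\det M) = (\det M)%:P.
Proof.
move=> sM; rewrite -det_map_mx -(det_map_mx polyC); congr (\det _).
by apply/matrixP=> i j; rewrite !mxE sM.
Qed.

Lemma expansion_row_form i j i' sigma :
  x_expansion i j sigma -> (i' <= n)%N -> i' != i -> sigma (g i') = (g i')%:P.
Proof.
move=> [_ _ sx sy] lei'n nei'; rewrite /g !rmorph_sum; apply: eq_bigr => k _ /=.
by rewrite !rmorphM /= sx ?sy // xpair_eqE (negPf nei').
Qed.

(** The bound by [maxn i j] says that position (i, j) lies outside the corner. *)
Lemma expansion_corner i j m sigma :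
  x_expansion i j sigma -> (m <= n)%N -> (m <= maxn i j)%N ->
  sigma (\det (corner m)) = (\det (corner m))%:P.
Proof.
move=> [_ _ sx sy] lemn leij; apply: expansion_det => k l; rewrite !mxE sx //.
- by apply: leq_trans lemn; exact: ltnW.
- exact: leq_trans lemn.
- rewrite xpair_eqE; apply/negP => /andP[/eqP ki /eqP lj].
  by move: (ltn_ord k) (ltn_ord l); lia.
Qed.

(** As a polynomial in x_ij, the form g_i is linear with leading coefficient y_j. *)
Lemma nzd_row_form (s : seq A) i j sigma :
  (i <= n)%N -> (j < n)%N -> x_expansion i j sigma ->
  {in s, forall f, sigma f = f%:P} -> nzd_mod s (y j) -> nzd_mod s (g i).
Proof.
move=> lein ltjn xs ss nzy; have [sK sX sx sy] := xs.
rewrite /g (bigD1 (Ordinal ltjn)) //= [x i j * _]mulrC.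
apply: (nzd_mod_linear sK sX) => //; first exact: sy.
rewrite !rmorph_sum; apply: eq_bigr => k nekj /=.
by rewrite !rmorphM /= sx ?sy // xpair_eqE eqxx.
Qed.

(** Induction on i. To add g_i to the ideal, the induction hypothesis is used twice: y_m is regular
    modulo the old ideal, and y_i is regular once y_m is added to it. The latter makes g_i regular
    there, and [nzd_mod_swap] exchanges y_m and g_i. *)
Lemma nzd_y_row_forms i Z m : (i <= n)%N ->
  all (fun k => i <= k < n)%N (m :: Z) -> m \notin Z ->
  nzd_mod (map y Z ++ J i) (y m).
Proof.
elim: i Z m => [|i IHi] Z m lein allZ nZm.
  have [ltmn Zn] := andP allZ; have [sigma [sK sX sy]] := y_indet ltmn.
  rewrite cats0 -[y m]mul1r -[1 * y m]addr0.
  apply: (nzd_mod_linear sK sX); rewrite ?rmorph1 ?rmorph0 //; last first.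
    by move=> u; rewrite mul1r.
  move=> _ /mapP[k Zk ->]; apply: sy; first by have := allP Zn _ Zk.
  by apply: contraNneq nZm => <-.
have allZ' : all (fun k => i <= k < n)%N (m :: Z).
  by apply: sub_all allZ => k; lia.
apply: (@nzd_mod_eq_mem _ (g i :: map y Z ++ J i)).
  by move=> z; rewrite mkseqS inE !mem_cat mem_rcons inE orbCA.
apply: nzd_mod_swap; first by apply: IHi => //; exact: ltnW.
have [sigma xs] := x_indet (ltnW lein) lein.
apply: (@nzd_row_form _ i i sigma) => //; first exact: ltnW.
  have [_ _ _ sy] := xs.
  move=> f; rewrite inE mem_cat => /or3P[/eqP->|/mapP[k Zk ->]|/mapP[k]].
  - by apply: sy; have /andP[/andP[]] := allZ.
  - by apply: sy; have /andP[_ /allP/(_ _ Zk)/andP[]] := allZ.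
  rewrite mem_iota => lki ->; apply: (expansion_row_form xs); lia.
apply: (IHi (m :: Z)) => //; first exact: ltnW.
  by rewrite /= leqnn lein.
apply/negP => /(allP allZ); lia.
Qed.

Lemma nzd_row_forms i : (i < n)%N -> nzd_mod (J i) (g i).
Proof.
move=> ltin; have [sigma xs] := x_indet (ltnW ltin) ltin.
apply: (nzd_row_form (ltnW ltin) ltin xs) => [f /mapP[k]|].
  rewrite mem_iota => lki ->; apply: (expansion_row_form xs); lia.
by apply: (@nzd_y_row_forms i [::] i); rewrite //= ?leqnn ?ltin // ltnW.
Qed.

Lemma cofactor_corner m :
  cofactor (corner m.+1) ord_max ord_max = \det (corner m).
Proof.
rewrite /cofactor -signr_odd addnn odd_double mul1r; congr (\det _).
by apply/matrixP=> i j; rewrite !mxE !lift_max.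
Qed.

(** Expanded along its last row, the minor of size m + 1 is linear in its last diagonal entry, with
    the minor of size m as leading coefficient. *)
Lemma nzd_det_corner m : (m <= n)%N -> nzd_mod (mkseq y n) (\det (corner m)).
Proof.
elim: m => [_ u|m IHm ltmn]; first by rewrite det_mx00 mul1r.
have [sigma xs] := x_indet (ltnW ltmn) ltmn; have [sK sX sx sy] := xs.
rewrite (expand_det_row _ ord_max) big_ord_recr /= addrC mxE cofactor_corner.
rewrite [x m m * _]mulrC; apply: (nzd_mod_linear sK sX).
- by move=> f /mapP[k]; rewrite mem_iota => ltkn ->; exact: sy.
- by apply: (expansion_corner xs); [exact: ltnW | rewrite maxnn].
- rewrite !rmorph_sum; apply: eq_bigr => k _ /=.
  rewrite !rmorphM /= mxE sx ?(leq_trans (ltn_ord _)) ?(ltnW ltmn) //=; last first.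
    by rewrite xpair_eqE eqxx /= ltn_eqF.
  congr (_ * _); rewrite /cofactor !rmorphXn !rmorphN1.
  congr (_ * _); apply: expansion_det => i j; rewrite !mxE lift_max sx //.
  + by rewrite (leq_trans _ (ltnW ltmn)) // ltnW.
  + exact: leq_trans (ltn_ord (lift _ _)) _.
  + by rewrite xpair_eqE ltn_eqF.
- by apply: IHm; exact: ltnW.
Qed.

(* The adjugate of the corner, applied to the truncated product X Y. *)
Lemma det_corner_adj m (j : 'I_m) : (m <= n)%N ->
  y j * \det (corner m) - \sum_(i < m) (\adj (corner m)) j i * g i
    \in ideal_gen (map y (index_iota m n)).
Proof.
move=> lemn; set M := corner m; pose v := \col_(k < m) y k.
have <- : (\adj M *m (M *m v)) j 0 = y j * \det M.
  by rewrite mulmxA mul_adj_mx mul_scalar_mx !mxE mulrC.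
rewrite mxE -sumrB rpred_sum // => i _; rewrite -mulrBr ideal_genMl //.
rewrite mxE /g -(big_mkord predT (fun k => x i k * y k)).
rewrite (@big_cat_nat _ _ _ m) //= big_mkord opprD addrA.
rewrite [X in X - _](_ : _ = 0) ?sub0r ?rpredN.
  rewrite big_nat rpred_sum // => k ltmkn; apply/ideal_genMl/mem_ideal_gen.
  by rewrite map_f ?mem_index_iota.
by apply/eqP; rewrite subr_eq0; apply/eqP; apply: eq_bigr => k _; rewrite !mxE.
Qed.

(** In the adjugate sum of [det_corner_adj], all terms but the last lie in [J m]. *)
Lemma det_corner_cofactor m (j : 'I_m.+1) : (m < n)%N ->
  y j * \det (corner m.+1) - cofactor (corner m.+1) ord_max j * g m
    \in ideal_gen (map y (index_iota m.+1 n) ++ J m).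
Proof.
move=> /(det_corner_adj j); rewrite big_ord_recr mxE /= => yD.
set s := \sum_(i < m) _ in yD.
rewrite -(subrK s (_ - _)) rpredD //.
  rewrite -addrA -opprD [_ + s]addrC; apply: ideal_gen_mono yD => z.
  by rewrite mem_cat => ->.
rewrite rpred_sum // => i _; rewrite ideal_genMl // mem_ideal_gen //.
by rewrite mem_cat mem_mkseq ?orbT.
Qed.

(** For m = n no y_k is left over in Cramer's rule, so each y_j D_n lies in [J n]; and [g n] is a
    combination of the y_j. *)
Lemma det_corner_row_form : \det (corner n) * g n \in ideal_gen (J n).
Proof.
rewrite /g mulr_sumr rpred_sum // => j _; rewrite mulrCA ideal_genMl // mulrC.
have := det_corner_adj j (leqnn n); rewrite /index_iota subnn /= => yD.
rewrite -(subrK (\sum_(i < n) (\adj (corner n)) j i * g i) (_ * _)) rpredD //.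
  by apply: ideal_gen_mono yD.
apply/ideal_gen_mkseqP.
exists (fun i => if insub i is Some k then (\adj (corner n)) j k else 0).
by apply: eq_bigr => i _; rewrite valK.
Qed.

Lemma row_form_mem_ys i : g i \in ideal_gen (mkseq y n).
Proof. by apply/ideal_gen_mkseqP; exists (x i). Qed.

Lemma nzd_row_form_corner m : (m <= n)%N ->
  nzd_mod (\det (corner m) :: map y (index_iota m n) ++ J m) (g m).
Proof.
elim: m => [_ u _|m IHm ltmn].
  rewrite -[u]mulr1 ideal_genMl // mem_ideal_gen // det_mx00; exact: mem_head.
have {}IHm := IHm (ltnW ltmn).
set D := \det _; pose L := map y (index_iota m.+1 n) ++ J m.
have dc := @det_corner_cofactor m _ ltmn; rewrite -/D -/L in dc.
(* The entry of row m + 1 and column m lies just below the corner and has coefficient [y m] in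
   [g m.+1]. *)
suff nzy : nzd_mod (D :: g m :: L) (y m).
  have [sigma xs] := x_indet ltmn ltmn; have [_ _ _ sy] := xs.
  apply: (nzd_row_form ltmn ltmn xs) => [f|]; last first.
    apply: nzd_mod_eq_mem nzy => z; rewrite mkseqS !(inE, mem_cat) mem_rcons inE.
    by rewrite [(z == g m) || _]orbCA.
  rewrite inE mem_cat => /or3P[/eqP->|/mapP[k]|/mapP[k]].
  - by apply: (expansion_corner xs) => //; rewrite leq_maxl.
  - by rewrite mem_index_iota => /andP[_ ltkn] ->; apply: sy.
  - by rewrite mem_iota => ltkm ->; apply: (expansion_row_form xs); lia.
have L_ys : {subset ideal_gen L <= ideal_gen (mkseq y n)}.
  apply: ideal_gen_subset => f; rewrite mem_cat => /orP[] /mapP[k].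
    rewrite mem_index_iota => /andP[_ ltkn] ->.
    by rewrite mem_ideal_gen ?mem_mkseq.
  by move=> _ ->; exact: row_form_mem_ys.
move=> u /ideal_gen_consP[b [_ [/ideal_gen_consP[a [l [Ll ->]]] yuE]]].
(* Every other term of [yuE] lies in the ideal of the y_j, modulo which [D] is regular. *)
have /ideal_gen_mkseqP[c bE] : b \in ideal_gen (mkseq y n).
  apply: (nzd_det_corner ltmn); rewrite mulrC.
  rewrite -(addrK (a * g m + l) (b * D)) -yuE rpredB //.
    by rewrite ideal_genMr ?mem_ideal_gen ?mem_mkseq.
  by rewrite rpredD ?(L_ys l) // ideal_genMl ?row_form_mem_ys.
have yDg (j : 'I_n) : exists d, y j * D - d * g m \in ideal_gen L.
  case: (leqP j m) => [lejm|ltmj].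
    pose k : 'I_m.+1 := Ordinal (lejm : (j < m.+1)%N).
    by exists (cofactor (corner m.+1) ord_max k); exact: (dc k).
  exists 0; rewrite mul0r subr0 ideal_genMr // mem_ideal_gen // mem_cat.
  by rewrite map_f // mem_index_iota ltmj ltn_ord.
have [d dP] := fin_all_exists yDg.
(* With b = sum of c_j y_j, each y_j D is traded for d_j [g m] modulo [L], so that [D] disappears
   from the equation for [y m * u]. *)
pose a' := a + \sum_(j < n) c j * d j.
have yu_a' : y m * u - a' * g m \in ideal_gen L.
  have -> : y m * u - a' * g m = \sum_(j < n) c j * (y j * D - d j * g m) + l.
    rewrite yuE bE /a' mulrDl !mulr_suml.
    under [in RHS]eq_bigr do rewrite mulrBr !mulrA.
    by rewrite sumrB; ring.
  by rewrite rpredD // rpred_sum // => j _; rewrite ideal_genMl.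
(* Since [a' * g m] is in the ideal of [y m] and [L], the induction hypothesis for the smaller
   corner applies to [a']. *)
have : a' \in ideal_gen (\det (corner m) :: y m :: L).
  rewrite /L -cat_cons -map_cons (_ : m :: _ = index_iota m n); last first.
    by rewrite /index_iota -(subnSK ltmn).
  apply: IHm; rewrite mulrC -(subrK (y m * u) (a' * g m)) rpredD //.
    rewrite -opprB rpredN; apply: ideal_gen_mono yu_a' => z.
    rewrite !(inE, mem_cat) => /orP[|->]; rewrite ?orbT //.
    move=> /mapP[k]; rewrite mem_index_iota => /andP[ltmk ltkn] ->.
    by rewrite map_f ?orbT // mem_index_iota ltkn (ltnW ltmk).
  rewrite ideal_genMr // mem_ideal_gen // inE mem_cat map_f ?orbT //.
  by rewrite mem_index_iota leqnn ltmn.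
move=> /ideal_gen_consP[v [_ [/ideal_gen_consP[w [l' [Ll' ->]]] a'E]]].
(* Modulo [L], y_m D_(m+1) equals D_m [g m]; this cancels the D_m part of [a'], after which [y m]
   cancels too. *)
have : u - w * g m - v * D \in ideal_gen L.
  have nzL : nzd_mod L (y m).
    apply: nzd_y_row_forms; first exact: ltnW.
      apply/allP => k; rewrite inE mem_index_iota => /orP[/eqP->|]; lia.
    by rewrite mem_index_iota ltnn.
  apply: nzL; have := dc ord_max; rewrite cofactor_corner => yD.
  have -> : y m * (u - w * g m - v * D) = (y m * u - a' * g m)
      - v * (y m * D - \det (corner m) * g m) + l' * g m.
    by rewrite a'E; ring.
  by rewrite rpredD ?(ideal_genMr _ Ll') // rpredB // ideal_genMl.
move=> Lu; apply/ideal_gen_consP; exists v, (u - v * D); split; last by ring.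
apply/ideal_gen_consP; exists w, (u - w * g m - v * D); split=> //; ring.
Qed.

Lemma nzd_row_form_det : nzd_mod (\det (corner n) :: J n) (g n).
Proof. by have := nzd_row_form_corner (leqnn n); rewrite /index_iota subnn. Qed.

Lemma row_forms_sub_det :
  {subset ideal_gen (J n) <= ideal_gen (\det (corner n) :: J n)}.
Proof. by apply: ideal_gen_mono => z Jz; rewrite inE Jz orbT. Qed.

(** Together with [row_form_det_mul], this computes the colon ideal of [J n] by [g n] as (D_n) +
    [J n]. *)
Lemma row_forms_colon z :
  g n * z \in ideal_gen (J n) -> z \in ideal_gen (\det (corner n) :: J n).
Proof. by move=> /row_forms_sub_det/nzd_row_form_det. Qed.

Lemma row_form_det_mul z :
  z \in ideal_gen (\det (corner n) :: J n) -> g n * z \in ideal_gen (J n).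
Proof.
move=> /ideal_gen_consP[c [w [Jw ->]]]; rewrite mulrDr rpredD //; last exact: ideal_genMl.
by rewrite mulrCA ideal_genMl // mulrC det_corner_row_form.
Qed.

(** This is the property from which linear type is deduced. For i = n, write z = c g_n + w with w in
    [J n]. The colon ideal puts z, hence c g_n, in (D_n) + [J n]; so c is there by regularity of
    g_n, and c g_n is in [J n]. *)
Lemma row_forms_colon_cap i z : (i <= n)%N ->
  g i * z \in ideal_gen (J i) -> z \in ideal_gen (J n.+1) ->
  z \in ideal_gen (J i).
Proof.
rewrite leq_eqVlt => /orP[/eqP->|/nzd_row_forms nzg /nzg//] gz.
rewrite mkseqS => Jz; have {Jz}/ideal_gen_consP[c [w [Jw zE]]] :
    z \in ideal_gen (g n :: J n).
  by apply: ideal_gen_mono Jz => f; rewrite mem_rcons.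
suff : g n * c \in ideal_gen (J n) by rewrite zE [c * _]mulrC => gc; rewrite rpredD.
apply/row_form_det_mul/nzd_row_form_det.
have -> : g n * c = z - w by rewrite zE addrK mulrC.
by rewrite rpredB ?(row_forms_sub_det Jw) // row_forms_colon.
Qed.

Lemma d_sequence_row_forms : d_sequence (J n.+1).
Proof.
move=> i j; rewrite size_mkseq /= => lein /andP[ltij lejn].
have JE : ideal_gen (take i.+1 (0 :: J n.+1)) =i ideal_gen (J i).
  have -> : take i.+1 (0 :: J n.+1) = 0 :: J i.
    by rewrite /= -map_take take_iota (minn_idPl _) // ltnW.
  move=> z; apply/idP/idP => [/ideal_gen_consP[c [w [Jw ->]]]|Jz].
    by rewrite mulr0 add0r.
  by apply/ideal_gen_consP; exists 0, z; rewrite mulr0 add0r.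
case: j ltij lejn => // j ltij lejn z; rewrite !inE /= !JE !nth_mkseq ?ltnS //.
apply/idP/idP => [|gz]; last by rewrite mulrCA ideal_genMl.
(* For i < n the form g_i is regular modulo [J i]. For i = n only the last form remains as g_j, and
   z g_n^2 in [J n] puts z g_n, then z, in (D_n) + [J n]. *)
rewrite mulrCA => gz; move: lein; rewrite leq_eqVlt => /orP[/eqP iE|ltin]; last first.
  exact: nzd_row_forms gz.
have jE : j = n by lia.
rewrite jE iE in gz *; rewrite mulrC; apply/row_form_det_mul/nzd_row_form_det.
by rewrite [g n * z]mulrC row_forms_colon.
Qed.

End GenericMatrix.

(** * Linear type *)

Lemma dhomog0_const (A : comNzRingType) m (F : {mpoly A[m]}) :
  F \is 0.-homog -> F = (F@_0%MM)%:MP.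
Proof.
move=> F0; apply/mpolyP => k; rewrite mcoeffC.
have [->|nz_k] := eqVneq 0%MM k; first by rewrite mulr1.
by rewrite mulr0 (dhomog_nemf_coeff F0) // mdeg_eq0 eq_sym.
Qed.

Lemma dhomogXl (A : comNzRingType) m d (i : 'I_m) (F : {mpoly A[m]}) :
  F \is d.-homog -> 'X_i * F \is d.+1.-homog.
Proof.
move=> Fh; have X1 : 'X_i \is [in A[m], 1.-homog] by rewrite dhomogX /= mdeg1.
exact: dhomogM X1 Fh.
Qed.

(** Each monomial of positive degree is assigned to one variable dividing it. Indexing [H] by
    natural numbers allows partial sums later. *)
Lemma dhomogS_split (A : comNzRingType) n d (F : {mpoly A[n.+1]}) :
  F \is d.+1.-homog ->
  exists H : nat -> {mpoly A[n.+1]}, (forall k, H k \is d.-homog) /\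
    F = \sum_(k < n.+1) 'X_(inord k) * H k.
Proof.
move=> /dhomogP F_hom; rewrite (mpolyE F) big_seq.
pose P (G : {mpoly A[n.+1]}) := exists H : nat -> {mpoly A[n.+1]},
  (forall k, H k \is d.-homog) /\ G = \sum_(k < n.+1) 'X_(inord k) * H k.
apply: (big_ind P) => [|F1 F2 [H1 [H1h ->]] [H2 [H2h ->]]|m /F_hom mdeg_m].
- by exists (fun=> 0); split=> [k|]; rewrite ?dhomog0 // big1 // => k; rewrite mulr0.
- exists (fun k => H1 k + H2 k); split=> [k|]; first exact: dhomogD.
  by rewrite -big_split; apply: eq_bigr => k _; rewrite /= mulrDr.
have [i nz_mi] : exists i, m i != 0%N.
  apply/existsP; rewrite -negb_forall; apply/negP => /forallP m0.
  by move: mdeg_m; rewrite /= mdegE big1 // => i _; apply/eqP.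
exists (fun k : nat => if k == i :> nat then F@_m *: 'X_[m - U_(i)] else 0); split=> [k|].
  case: eqP => _; last exact: dhomog0.
  rewrite dhomogZ // dhomogX /= -(eqn_add2r 1%N) -(mdeg1 i) -mdegD.
  by rewrite submK ?lep1mP // mdeg_m mdeg1 addn1.
rewrite (bigD1 i) //= eqxx inord_val big1 ?addr0 => [|k neki].
  by rewrite -scalerAr -mpolyXD addmC submK // lep1mP.
by rewrite val_eqE (negPf neki) mulr0.
Qed.

Section LinearType.
Variables (A : comNzRingType) (n : nat) (g : nat -> A).
Local Notation B := {mpoly A[n.+1]}.
Local Notation T k := ('X_(inord k) : B).
Local Notation J i := (mkseq g i).
Local Notation "F ^g" := (F.@[fun k : 'I_n.+1 => g k]) (at level 2, format "F ^g").

Hypothesis colon_cap : forall i z, (i <= n)%N ->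
  g i * z \in ideal_gen (J i) -> z \in ideal_gen (J n.+1) ->
  z \in ideal_gen (J i).

Lemma meval_inordX k : (k <= n)%N -> (T k)^g = g k.
Proof. by move=> lekn; rewrite mevalXU inordK. Qed.

Lemma meval_sumTX i (H : nat -> B) : (i <= n.+1)%N ->
  (\sum_(k < i) T k * H k)^g = \sum_(k < i) g k * (H k)^g.
Proof.
move=> lein; rewrite raddf_sum; apply: eq_bigr => k _ /=.
rewrite mevalM meval_inordX //; have := ltn_ord k; lia.
Qed.

Lemma meval_dhomogS d (F : B) : F \is d.+1.-homog -> F^g \in ideal_gen (J n.+1).
Proof.
move=> /dhomogS_split[H [_ ->]]; rewrite meval_sumTX //; apply/ideal_gen_mkseqP.
by exists (fun k => (H k)^g); apply: eq_bigr => k _; rewrite mulrC.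
Qed.

(* For J = J_(n+1) this is the inclusion of J_i \cap J^(d+1) in J_i J^d, the
   elements of J^d being the values at g of the forms of degree d. *)
Lemma meval_dhomog_cap d i (F : B) : (i <= n.+1)%N -> F \is d.+1.-homog ->
  F^g \in ideal_gen (J i) ->
  exists H : nat -> B, (forall k, H k \is d.-homog) /\
    F^g = \sum_(k < i) g k * (H k)^g.
Proof.
elim: d i F => [|d IHd] i F lein F_hom.
  move=> /ideal_gen_mkseqP[c ->]; exists (fun k => (c k)%:MP); split=> [k|].
    by rewrite -[_%:MP]mulr1 mul_mpolyC dhomogZ ?dhomog1.
  by apply: eq_bigr => k _; rewrite mevalC mulrC.
(* Descending induction on i, starting from i = n + 1, where splitting [F] is enough. *)
have [e] := ubnP (n.+1 - i); elim: e i lein => // e IHe i.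
rewrite leq_eqVlt => /orP[/eqP-> _ _|ltin leie JFi].
  have [H [Hh FE]] := dhomogS_split F_hom.
  by exists H; split=> //; rewrite {1}FE meval_sumTX.
have [||H [Hh]] := IHe i.+1 ltin; first lia.
  by apply: ideal_gen_mono JFi => z; rewrite mkseqS mem_rcons inE orbC => ->.
rewrite big_ord_recr /= => FE.
(* By [colon_cap] the value of H_i is in [J i], so the induction on the degree writes it as a sum of
   g_k G_k(g) with k < i; the products g_i g_k G_k(g) then join the terms in g_k. *)
have [|G [Gh HiE]] := IHd i (H i) (ltnW ltin) (Hh i).
  apply: colon_cap => //; last exact: meval_dhomogS (Hh i).
  have -> : g i * (H i)^g = F^g - \sum_(k < i) g k * (H k)^g.
    by rewrite FE addrAC subrr add0r.
  rewrite rpredB // rpred_sum // => k _; rewrite ideal_genMr //.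
  by rewrite mem_ideal_gen ?mem_mkseq.
exists (fun k => H k + T i * G k); split=> [k|].
  by rewrite dhomogD // dhomogXl.
rewrite FE HiE mulr_sumr -big_split; apply: eq_bigr => k _ /=.
by rewrite mevalD mevalM meval_inordX // mulrDr mulrCA.
Qed.

Variable s : seq B.
Hypothesis syzygies : forall c : nat -> A,
  \sum_(k < n.+1) c k * g k = 0 ->
  \sum_(k < n.+1) (c k)%:MP * T k \in ideal_gen s.

Lemma dhomog_relation d (F : B) :
  F \is d.-homog -> F^g = 0 -> F \in ideal_gen s.
Proof.
elim: d F => [|[|d] IHd] F F_hom.
- by rewrite (dhomog0_const F_hom) mevalC => ->; rewrite mpolyC0 rpred0.
- have [H [Hh ->]] := dhomogS_split F_hom; rewrite meval_sumTX // => H0.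
  under eq_bigr do rewrite (dhomog0_const (Hh _)) mulrC.
  apply: (syzygies (c := fun k => (H k)@_0%MM)); rewrite -[RHS]H0; apply: eq_bigr => k _.
  by rewrite [in RHS](dhomog0_const (Hh _)) mevalC mulrC.
(* From degree 2 on, an inner induction on i removes the leading factors T_k one at a time. *)
suff partial_sum i (H : nat -> B) : (forall k, H k \is d.+1.-homog) ->
    (i <= n.+1)%N -> (\sum_(k < i) T k * H k)^g = 0 ->
    \sum_(k < i) T k * H k \in ideal_gen s.
  by have [H [Hh ->]] := dhomogS_split F_hom; exact: partial_sum.
elim: i H => [|i IHi] H Hh ltin.
  by rewrite big_ord0 rpred0.
rewrite meval_sumTX // big_ord_recr /= => HE.
have [|G [Gh HiE]] := meval_dhomog_cap (ltnW ltin) (Hh i).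
  apply: colon_cap => //; last exact: meval_dhomogS (Hh i).
  rewrite -[g i * _](addKr (\sum_(k < i) g k * (H k)^g)) HE addr0 rpredN.
  rewrite rpred_sum // => k _; rewrite ideal_genMr //.
  by rewrite mem_ideal_gen ?mem_mkseq.
(* [E] vanishes at g and has one degree less than [F]. Up to T_i [E], the term T_i H_i is thus
   spread over the T_k with k < i. *)
pose E := H i - \sum_(k < i) T k * G k.
have sE : E \in ideal_gen s.
  apply: IHd.
    rewrite rpredB ?Hh // rpred_sum // => k _.
    exact: dhomogXl.
  by rewrite mevalB meval_sumTX ?(ltnW ltin) // HiE subrr.
have -> : \sum_(k < i.+1) T k * H k
    = \sum_(k < i) T k * (H k + T i * G k) + T i * E.
  rewrite big_ord_recr /= /E mulrBr mulr_sumr.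
  under [in RHS]eq_bigr do rewrite mulrDr.
  rewrite big_split /= -!addrA; congr (_ + _).
  rewrite addrCA [X in _ + (X - _)](_ : _ = \sum_(k < i) T i * (T k * G k)).
    by rewrite subrr addr0.
  by apply: eq_bigr => k _; rewrite mulrCA.
rewrite rpredD ?ideal_genMl //.
pose H' k := H k + T i * G k; apply: (IHi H') => [k||].
- by rewrite dhomogD // dhomogXl.
- exact: ltnW.
rewrite meval_sumTX ?(ltnW ltin) // -[RHS]HE HiE mulr_sumr -big_split.
by apply: eq_bigr => k _; rewrite mevalD mevalM meval_inordX // mulrDr mulrCA.
Qed.

Lemma dhomog_rees (phi : {rmorphism B -> {poly A}}) d (F : B) :
  (forall c, phi c%:MP = c%:P) ->
  (forall k : 'I_n.+1, phi 'X_k = g k *: 'X) ->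
  F \is d.-homog -> phi F = F^g *: 'X^d.
Proof.
move=> phiC phiX /dhomogP Fh; rewrite (mpolyE F) raddf_sum [in RHS]raddf_sum /=.
rewrite scaler_suml !big_seq; apply: eq_bigr => m /Fh <-.
rewrite -mul_mpolyC rmorphM phiC mevalM mevalC -scalerA mul_polyC; congr (_ *: _).
rewrite mpolyXE_id !rmorph_prod /= mdegE.
rewrite -prodrXr -scaler_prod; apply: eq_bigr => k _.
by rewrite !rmorphXn /= phiX mevalXU exprZn.
Qed.

(** The components of [F] of distinct degrees map to distinct powers of t, so each of them vanishes
    at g separately. *)
Lemma rees_kernel (phi : {rmorphism B -> {poly A}}) (F : B) :
  (forall c, phi c%:MP = c%:P) ->
  (forall k : 'I_n.+1, phi 'X_k = g k *: 'X) ->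
  phi F = 0 -> F \in ideal_gen s.
Proof.
move=> phiC phiX; have FE := pihomog_partitionE (leqnn (msize F)).
rewrite [in X in X -> _]FE raddf_sum /= => phiF0.
have Fg d : (d < msize F)%N -> (pihomog mdeg d F)^g = 0.
  move=> ltdF; have /(congr1 (fun p : {poly A} => p`_d)) := phiF0.
  under eq_bigr do rewrite (dhomog_rees phiC phiX (pihomogP _ _ _)).
  by rewrite -(poly_def _ (fun d => (pihomog mdeg d F)^g)) coef_poly ltdF coef0.
rewrite FE rpred_sum // => d _.
by apply: (dhomog_relation (pihomogP _ _ _)); apply: Fg.
Qed.

End LinearType.

(** * Linear syzygies from Koszul relations and one extra relation *)

Section Syzygies.
Variables (A : comNzRingType) (n : nat) (g : nat -> A) (s : seq {mpoly A[n.+1]}).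
Local Notation T k := ('X_(inord k) : {mpoly A[n.+1]}).
Local Notation J i := (mkseq g i).

Hypothesis koszul : forall i j, (i <= n)%N -> (j <= n)%N ->
  T i * (g j)%:MP - T j * (g i)%:MP \in ideal_gen s.

Definition linear_syzygies i : Prop := forall c : nat -> A,
  \sum_(k < i) c k * g k = 0 -> \sum_(k < i) (c k)%:MP * T k \in ideal_gen s.

(** If c_i is the sum of the e_k g_k, Koszul relations move the term c_i T_i onto the T_k with k <
    i, changing c_k into c_k + e_k g_i. *)
Lemma syzygy_step i (c : nat -> A) : (i <= n)%N -> linear_syzygies i ->
  c i \in ideal_gen (J i) -> \sum_(k < i.+1) c k * g k = 0 ->
  \sum_(k < i.+1) (c k)%:MP * T k \in ideal_gen s.
Proof.
move=> lein syz /ideal_gen_mkseqP[e cE]; rewrite !big_ord_recr /= {1}cE => c0.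
have -> : \sum_(k < i) (c k)%:MP * T k + (c i)%:MP * T i =
    \sum_(k < i) (c k + e k * g i)%:MP * T k
    + \sum_(k < i) (e k)%:MP * (T i * (g k)%:MP - T k * (g i)%:MP).
  rewrite cE (raddf_sum (@mpolyC _ _)) mulr_suml -!big_split /=.
  by apply: eq_bigr => k _; rewrite mpolyCD !mpolyCM; ring.
rewrite rpredD //; last first.
  rewrite rpred_sum // => k _; rewrite ideal_genMl ?koszul //.
  by rewrite ltnW // (leq_trans (ltn_ord k)).
apply: (syz (fun k => c k + e k * g i)).
rewrite -[RHS]c0 mulr_suml -big_split; apply: eq_bigr => k _ /=; ring.
Qed.

Lemma linear_syzygiesS i : (i <= n)%N -> nzd_mod (J i) (g i) ->
  linear_syzygies i -> linear_syzygies i.+1.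
Proof.
move=> lein nzg syz c c0; apply: syzygy_step => //; apply: nzg.
move: c0; rewrite big_ord_recr /= => /(canRL (addKr _)); rewrite addr0 mulrC => ->.
by rewrite rpredN; apply/ideal_gen_mkseqP; exists c.
Qed.

(* The relation [r] makes up for J_n : g_n being bigger than J_n. *)
Lemma linear_syzygies_last (r : nat -> A) :
  \sum_(k < n.+1) (r k)%:MP * T k \in ideal_gen s ->
  \sum_(k < n.+1) r k * g k = 0 ->
  (forall z, g n * z \in ideal_gen (J n) -> z \in ideal_gen (r n :: J n)) ->
  linear_syzygies n -> linear_syzygies n.+1.
Proof.
move=> sr r0 colon syz c c0.
have /colon/ideal_gen_consP[a [w [Jw cE]]] : g n * c n \in ideal_gen (J n).
  move: c0; rewrite big_ord_recr /= => /(canRL (addKr _)); rewrite addr0 mulrC => ->.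
  by rewrite rpredN; apply/ideal_gen_mkseqP; exists c.
(* Subtracting [a] times the relation [r] brings the last coefficient into [J n], as [syzygy_step]
   requires. *)
pose c' k := c k - a * r k.
have -> : \sum_(k < n.+1) (c k)%:MP * T k = \sum_(k < n.+1) (c' k)%:MP * T k
    + a%:MP * \sum_(k < n.+1) (r k)%:MP * T k.
  rewrite mulr_sumr -big_split; apply: eq_bigr => k _ /=.
  by rewrite /c' mpolyCB !mpolyCM; ring.
rewrite rpredD ?ideal_genMl //; apply: syzygy_step => //.
  by rewrite /c' cE addrAC subrr add0r.
under eq_bigr do rewrite /c' mulrBl -mulrA.
by rewrite sumrB c0 -mulr_sumr r0 mulr0 subrr.
Qed.

End Syzygies.

(** * Algebra morphisms from quotients and to Rees algebras *)

Section QuotientLift.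
Variables (A : comNzRingType) (B : comAlgType A) (I : idealr B).
Variables (C : lalgType A) (f : {lrmorphism B -> C}).
Hypothesis fI : forall x, x \in I -> f x = 0.

Definition quot_lift (q : {ideal_quot I}) : C := f (repr q).

Lemma quot_liftE x : quot_lift (\pi_({ideal_quot I})%qT x) = f x.
Proof.
apply/eqP; rewrite -subr_eq0 -rmorphB; apply/eqP/fI.
by rewrite Quotient.idealrBE reprK.
Qed.

Fact quot_lift_zmod_morphism : zmod_morphism quot_lift.
Proof.
move=> p q; rewrite -[p]reprK -[q]reprK -rmorphB !quot_liftE; exact: rmorphB.
Qed.

Fact quot_lift_monoid_morphism : monoid_morphism quot_lift.
Proof.
split=> [|p q]; first by rewrite -(rmorph1 (\pi_({ideal_quot I})%qT)) quot_liftE rmorph1.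
rewrite -[p]reprK -[q]reprK -rmorphM !quot_liftE; exact: rmorphM.
Qed.

Fact quot_lift_scalable : scalable quot_lift.
Proof.
move=> a p; rewrite -[p]reprK.
(* Scaling by [a] in the quotient is, by definition, multiplication by the class of [a%:A]. *)
have -> : a *: \pi_({ideal_quot I})%qT (repr p) = \pi_({ideal_quot I})%qT (a *: repr p).
  by rewrite -[in RHS](mul1r (repr p)) scalerAl rmorphM.
by rewrite !quot_liftE linearZ.
Qed.

HB.instance Definition _ := GRing.isZmodMorphism.Build _ _ quot_lift
  quot_lift_zmod_morphism.
HB.instance Definition _ := GRing.isMonoidMorphism.Build _ _ quot_lift
  quot_lift_monoid_morphism.
HB.instance Definition _ := GRing.isScalable.Build A _ _ _ quot_lift
  quot_lift_scalable.

(** First isomorphism theorem; the inverse sends y to the class of a chosen preimage. *)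
Lemma quot_lift_bijective :
  (forall x, f x = 0 -> x \in I) -> (forall y, exists x, f x = y) ->
  exists h : {lrmorphism {ideal_quot I} -> C}, bijective h.
Proof.
move=> kerf surjf; exists (quot_lift : {lrmorphism {ideal_quot I} -> C}).
have [r rK] := choice surjf.
exists (fun y => \pi_({ideal_quot I})%qT (r y)) => [q|y]; last first.
  exact: etrans (quot_liftE _) (rK y).
rewrite -[RHS]reprK; apply/eqP; rewrite -Quotient.idealrBE; apply: kerf.
by apply/eqP; rewrite rmorphB subr_eq0; apply/eqP; exact: rK.
Qed.

End QuotientLift.

Section ReesCorestriction.
Variables (A : comNzRingType) (B : lalgType A) (J : {pred A}).
Variables (phi : {lrmorphism B -> {poly A}}).
Hypothesis phi_rees : forall x, phi x \in rees_pred J.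

Definition rees_corestrict (x : B) : rees_algebra J := ReesAlgebra (phi_rees x).

Fact rees_corestrict_zmod_morphism : zmod_morphism rees_corestrict.
Proof. by move=> x y; apply: val_inj; rewrite [RHS]rmorphB; exact: rmorphB. Qed.

Fact rees_corestrict_monoid_morphism : monoid_morphism rees_corestrict.
Proof.
split=> [|x y]; apply: val_inj; first exact: rmorph1.
by rewrite [RHS]rmorphM; exact: rmorphM.
Qed.

Fact rees_corestrict_scalable : scalable rees_corestrict.
Proof. by move=> a x; apply: val_inj; rewrite [RHS]linearZ; exact: linearZ. Qed.

HB.instance Definition _ := GRing.isZmodMorphism.Build _ _ rees_corestrict
  rees_corestrict_zmod_morphism.
HB.instance Definition _ := GRing.isMonoidMorphism.Build _ _ rees_corestrict
  rees_corestrict_monoid_morphism.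
HB.instance Definition _ := GRing.isScalable.Build A _ _ _ rees_corestrict
  rees_corestrict_scalable.

Lemma rees_corestrict_lrmorphism :
  exists f : {lrmorphism B -> rees_algebra J}, forall x, rees_val (f x) = phi x.
Proof. by exists (rees_corestrict : {lrmorphism B -> rees_algebra J}). Qed.

End ReesCorestriction.

Lemma bijective_quot_rees (A : comNzRingType) (B : comAlgType A)
    (I : idealr B) (J : {pred A}) (phi : {lrmorphism B -> {poly A}}) :
  (forall x, (x \in I) = (phi x == 0)) ->
  (forall p, reflect (exists x, phi x = p) (p \in rees_pred J)) ->
  exists f : {lrmorphism {ideal_quot I} -> rees_algebra J}, bijective f.
Proof.
move=> kerphi imphi.
have [|f fE] := @rees_corestrict_lrmorphism A B J phi.
  by move=> x; apply/imphi; exists x.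
apply: (@quot_lift_bijective A B I (rees_algebra J) f) => [x||y].
- by rewrite kerphi => /eqP x0; apply: val_inj; rewrite /= fE x0.
- by move=> x /(congr1 (@rees_val _ _)); rewrite fE kerphi => ->; exact/eqP.
have /imphi[x xE] := valP y; exists x; apply: val_inj; rewrite -[RHS]xE; exact: fE.
Qed.

Lemma rees_map (A : comNzRingType) n (g : 'I_n -> A) :
  exists phi : {lrmorphism {mpoly A[n]} -> {poly A}},
    (forall c, phi c%:MP = c%:P) /\ (forall k, phi 'X_k = g k *: 'X).
Proof.
pose h k : {poly A} := g k *: 'X.
have phi_scalable : scalable (mmap (@polyC A) h).
  by move=> c p; rewrite mmapZ mul_polyC.
pose phi_mixin := GRing.isScalable.Build A {mpoly A[n]} {poly A} _ _ phi_scalable.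
pose phi : {lrmorphism {mpoly A[n]} -> {poly A}} :=
  HB.pack (mmap (@polyC A) h) phi_mixin.
by exists phi; split=> [c|k]; rewrite /= ?mmapC ?mmapX ?mmap1U.
Qed.

(** * The polynomial ring in the entries of X and Y *)

(* The n+1 maximal minors of X give a linear relation between the entries of
   X Y: expand the singular determinant of the matrix [X Y | X]. *)
Lemma sum_minors_mulmx (A : comNzRingType) n (X : 'M[A]_(n.+1, n)) (Y : 'cV[A]_n) :
  \sum_(k < n.+1) (-1) ^+ k * \det (row' k X) * (X *m Y) k 0 = 0.
Proof.
pose M := \matrix_(i < n.+1, j < n.+1)
  if unlift ord0 j is Some j' then X i j' else (X *m Y) i 0.
(* [M] kills the column (-1, Y). Multiplying by the adjugate gives det M times this column, whose
   entry -1 forces det M = 0 over any commutative ring. *)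
pose v := \col_(j < n.+1) if unlift ord0 j is Some j' then Y j' 0 else -1.
have Mv0 : M *m v = 0.
  apply/matrixP=> i j; rewrite !mxE big_ord_recl !mxE unlift_none mulrN1.
  by rewrite addrC -sumrB big1 // => k _; rewrite !mxE liftK subrr.
have := mul_adj_mx M; move=> /(congr1 (fun N => (N *m v) ord0 0)).
rewrite -mulmxA Mv0 mulmx0 mul_scalar_mx !mxE unlift_none mulrN1.
move=> /esym/eqP; rewrite oppr_eq0 => /eqP detM0; rewrite -[RHS]detM0.
rewrite (expand_det_col _ ord0); apply: eq_bigr => k _.
rewrite mulrC [M k _]mxE unlift_none /cofactor addn0; congr (_ * (_ * \det _)).
by apply/matrixP=> i j; rewrite !mxE liftK.
Qed.

Lemma mxvec_index_inj m n (i i' : 'I_m) (j j' : 'I_n) :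
  (mxvec_index i j == mxvec_index i' j') = ((i, j) == (i', j')).
Proof.
apply/eqP/eqP => [|[-> ->]//]; move=> /cast_ord_inj/enum_rank_inj; exact.
Qed.

Section PolynomialEntries.
Variables (K : fieldType) (n' : nat).
Local Notation n := n'.+1.
Local Notation S := {mpoly K[n.+1 * n + n]}.

(** Taking n to be a successor makes [inord] available for the columns; indices out of range fall
    back to 0. *)
Definition natX i j : S := genX K n (inord i) (inord j).
Definition natY j : S := genY K n (inord j) 0.

Lemma natX_indet i j : (i <= n)%N -> (j < n)%N ->
  exists sigma, x_expansion n natX natY i j sigma.
Proof.
move=> lein ltjn.
have [sigma [sK sX sP]] :=
  mpoly_expansion K (lshift n (mxvec_index (inord i : 'I_n.+1) (inord j : 'I_n))).
exists sigma; rewrite /natX /natY; split; rewrite ?mxE //.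
  move=> i' j' lei'n ltj'n neij; rewrite mxE; apply: sP.
  rewrite (inj_eq (@lshift_inj _ _)) mxvec_index_inj; apply: contra neij.
  rewrite !xpair_eqE => /andP[/eqP/(congr1 val)/= iE /eqP/(congr1 val)/= jE].
  by move: iE jE; rewrite !inordK // => -> ->; rewrite !eqxx.
by move=> j' ltj'n; rewrite mxE; apply: sP; rewrite eq_rlshift.
Qed.

Lemma natY_indet j : (j < n)%N -> exists sigma, y_expansion n natY j sigma.
Proof.
move=> ltjn.
have [sigma [sK sX sP]] :=
  mpoly_expansion K (rshift (n.+1 * n) (inord j : 'I_n)).
exists sigma; rewrite /natY; split; rewrite ?mxE //.
move=> j' ltj'n nejj'; rewrite mxE; apply: sP.
rewrite (inj_eq (@rshift_inj _ _)); apply: contra nejj' => /eqP/(congr1 val)/=.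
by rewrite !inordK // => ->.
Qed.

Local Notation G := (row_form n natX natY).

Lemma row_form_inord i : G i = g K (inord i : 'I_n.+1).
Proof. by apply: eq_bigr => j _; rewrite /natX /natY inord_val. Qed.

Lemma row_form_ord (i : 'I_n.+1) : G i = g K i.
Proof. by rewrite row_form_inord inord_val. Qed.

Lemma gseqE : gseq K n = mkseq G n.+1.
Proof.
rewrite /gseq /mkseq -val_enum_ord -map_comp; apply: eq_map => i /=.
by rewrite row_form_ord.
Qed.

Lemma det_cornerE : \det (corner natX n) = Delta K (@ord_max n).
Proof.
congr (\det _); apply/matrixP=> i j; rewrite !mxE /natX mxE inord_val.
congr ('X_(lshift _ (mxvec_index _ _))).
apply: val_inj; rewrite [RHS]lift_max /= inordK //.
exact: leq_trans (ltn_ord i) _.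
Qed.

(** Regularity of the first n forms leaves only Koszul syzygies among them. The last form is handled
    by the relation of the minors, whose last coefficient is D_n up to sign. *)
Lemma linear_syzygies_rees :
  linear_syzygies G (rees_relations K n) n.+1.
Proof.
have koszul i j : (i <= n)%N -> (j <= n)%N ->
    'X_(inord i) * (G j)%:MP - 'X_(inord j) * (G i)%:MP
      \in ideal_gen (rees_relations K n).
  move=> lein lejn; apply: mem_ideal_gen; rewrite !row_form_inord mem_rcons inE.
  apply/orP; right.
  apply: (allpairs_f (fun i j => 'X_i * (g K j)%:MP - 'X_j * (g K i)%:MP));
    by rewrite mem_enum.
have syz i : (i <= n)%N -> linear_syzygies G (rees_relations K n) i.
  elim: i => [_ c _|i IHi ltin]; first by rewrite big_ord0 rpred0.
  apply: linear_syzygiesS => //; [exact: ltnW | | exact/IHi/ltnW].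
  exact: (nzd_row_forms natX_indet natY_indet).
pose r k : S := (-1) ^+ k.+1 * Delta K (inord k : 'I_n.+1).
apply: (linear_syzygies_last koszul (r := r)); last exact: syz.
- apply: mem_ideal_gen; rewrite mem_rcons inE; apply/orP; left; apply/eqP.
  apply: eq_bigr => k _; rewrite /r inord_val mpolyCM; congr (_ * _ * _).
  by rewrite !(rmorphXn, rmorphN1).
- have := sum_minors_mulmx (genX K n) (genY K n).
  move=> /(congr1 -%R); rewrite oppr0 -sumrN => r0; rewrite -[RHS]r0.
  apply: eq_bigr => k _.
  by rewrite /r inord_val row_form_ord mxE exprS mulN1r !mulNr.
move=> z /(row_forms_colon natX_indet natY_indet) Jz.
apply: ideal_gen_subset Jz => f; rewrite inE => /orP[/eqP->|Jf]; last first.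
  by rewrite mem_ideal_gen // inE Jf orbT.
have -> : \det (corner natX n) = (-1) ^+ n.+1 * r n.
  rewrite /r mulrA -exprD addnn -signr_odd odd_double mul1r det_cornerE.
  by congr (Delta K _); apply: val_inj; rewrite /= inordK.
by rewrite ideal_genMl // mem_ideal_gen // mem_head.
Qed.

Lemma rees_ideal_kernel (phi : {rmorphism {mpoly S[n.+1]} -> {poly S}}) :
  (forall c, phi c%:MP = c%:P) -> (forall k, phi 'X_k = g K k *: 'X) ->
  forall F, (F \in rees_ideal K n) = (phi F == 0).
Proof.
move=> phiC phiX F; apply/idP/eqP => [|phiF0]; last first.
  apply: (rees_kernel _ linear_syzygies_rees phiC _ phiF0) => [i z|k].
    exact: (row_forms_colon_cap natX_indet natY_indet).
  by rewrite phiX row_form_ord.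
move: F; have ker0 : 0 \in [pred F | phi F == 0] by rewrite inE rmorph0.
move=> F sF; apply/eqP; move: F sF; apply: (ideal_gen_sub ker0).
  by move=> a u v; rewrite !inE rmorphD rmorphM => /eqP-> /eqP->; rewrite mulr0 addr0.
move=> F; rewrite mem_rcons inE => /orP[/eqP->|/allpairsP[[i j] [_ _ ->]]].
  (* The relation of the minors maps to t times the sum that vanishes by [sum_minors_mulmx], negated
     because its signs start from exponent 1. *)
  rewrite inE raddf_sum /=; apply/eqP; transitivity ((- \sum_(k < n.+1)
      (-1) ^+ k * \det (row' k (genX K n)) * (genX K n *m genY K n) k 0) *: 'X).
    rewrite -sumrN scaler_suml; apply: eq_bigr => k _.
    rewrite !rmorphM rmorphXn rmorphN1 phiC phiX.
    have -> : (-1) ^+ k.+1 * (Delta K k)%:P = ((-1) ^+ k.+1 * Delta K k)%:P.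
      by rewrite polyCM rmorphXn rmorphN1.
    rewrite mul_polyC scalerA mxE; congr (_ *: _).
    by rewrite exprS mulN1r !mulNr.
  by rewrite sum_minors_mulmx oppr0 scale0r.
rewrite inE rmorphB !rmorphM !phiC !phiX -!mul_polyC; apply/eqP => /=; ring.
Qed.

(** The image is a subalgebra containing all g_k t, hence contains the smallest one; conversely,
    monomials map to products of these generators. *)
Lemma rees_pred_image (phi : {lrmorphism {mpoly S[n.+1]} -> {poly S}}) :
  (forall c, phi c%:MP = c%:P) -> (forall k, phi 'X_k = g K k *: 'X) ->
  forall p, reflect (exists F, phi F = p)
    (p \in rees_pred (entry_ideal (genX K n *m genY K n))).
Proof.
move=> phiC phiX p; apply: (iffP idP) => [|[F <-]].
  rewrite entry_ideal_gE => /rees_pred_gen/(_ [pred p | `[< exists F, phi F = p >]]) im_p.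
  apply/asboolP/im_p; first split=> [|a u v|u v].
  - by apply/asboolP; exists 1; rewrite rmorph1.
  - move=> /asboolP[F <-] /asboolP[F' <-]; apply/asboolP; exists (a *: F + F').
    by rewrite linearP.
  - move=> /asboolP[F <-] /asboolP[F' <-]; apply/asboolP; exists (F * F').
    by rewrite rmorphM.
  move=> _ /mapP[k _ ->]; apply/asboolP; exists 'X_k; exact: phiX.
elim/mpolyind: F => [|c m F _ _ IHF]; first by rewrite linear0 rpred0.
rewrite linearP rpredD ?rpredZ // mpolyXE_id rmorph_prod rpred_prod // => k _.
rewrite rmorphXn rpredX //= phiX; apply/asboolP => P _; apply.
rewrite entry_ideal_gE mem_ideal_gen //; apply: map_f; exact: mem_enum.
Qed.

End PolynomialEntries.

Theorem theorem3p2 (K : fieldType) (n : nat) (n_ge2 : (2 <= n)%N) :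
  d_sequence (gseq K n) /\
  (exists f : {lrmorphism {ideal_quot (rees_ideal K n)} ->
                 rees_algebra (entry_ideal (genX K n *m genY K n))},
     bijective f).
Proof.
case: n n_ge2 => // n _; split.
  rewrite gseqE; exact: (d_sequence_row_forms (@natX_indet K n) (@natY_indet K n)).
have [phi [phiC phiX]] := rees_map (@g K n.+1).
(* Without the explicit rings, unification unfolds the canonical structures. *)
exact: (@bijective_quot_rees {mpoly K[n.+2 * n.+1 + n.+1]}
  {mpoly {mpoly K[n.+2 * n.+1 + n.+1]}[n.+2]} (rees_ideal K n.+1) _ phi
  (rees_ideal_kernel phiC phiX) (rees_pred_image phiC phiX)).
Qed.
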